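(* Let $n,m,k\ge1$, fix $i\in\{1,\dots,n\}$, and let $f\in L^2((0,1)^n)$, $h_1\in L^2((0,1)^m)$, $h_2\in L^2((0,1)^{k+n-1})$ be real-valued, with $f$ not a.e. constant. Define $g(x,\xi,\eta)=f(x)h_1(\xi)+h_2(x_{\sim i},\eta)$ for $x\in(0,1)^n$, $\xi\in(0,1)^m$, $\eta\in(0,1)^k$, and assume $\mathrm{Var}(g)>0$ and $\int h_1^2>0$. Then $S^g_{T_{x_i}}=\gamma_{f,h_1,h_2}S^f_{T_{x_i}}$, where $$\gamma_{f,h_1,h_2}=\frac{\int f^2\,dx-f_0^2}{\int f^2\,dx-\frac{f_0^2(h_1)_0^2}{\int h_1^2\,d\xi}+\frac{\int\int h_2^2\,dx_{\sim i}\,d\eta-(h_2)_0^2}{\int h_1^2\,d\xi}+2(h_1)_0\frac{(fh_2)_0-f_0(h_2)_0}{\int h_1^2\,d\xi}}.$$ If additionally $(h_1)_0(fh_2)_0\ge f_0(h_1)_0(h_2)_0$, then $S^g_{T_{x_i}}\le S^f_{T_{x_i}}$.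
   Context: All integrals are with respect to Lebesgue measure over unit cubes (inputs independent, uniform on $[0,1]$). $x_{\sim i}=(x_1,\dots,x_{i-1},x_{i+1},\dots,x_n)$. For a function $\varphi$, $\varphi_0=\int\varphi$ is its mean and $\mathrm{Var}(\varphi)=\int\varphi^2-\varphi_0^2$; in particular $(fh_2)_0=\int f(x)h_2(x_{\sim i},\eta)\,dx\,d\eta$. For square-integrable $\varphi$ of variables $(x,y)$ the total Sobol index of $x_i$ is $$S^{\varphi}_{T_{x_i}}=\frac{\int\varphi^2\,dx\,dy-\int\big(\int\varphi\,dx_i\big)^2dx_{\sim i}\,dy}{\mathrm{Var}(\varphi)}.$$ *)

(* Defs.v *)
From HB Require Import structures.
From mathcomp Require Import all_boot all_order all_algebra.
From mathcomp Require Import all_classical all_reals all_analysis.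
Set Implicit Arguments.
Unset Strict Implicit.
Unset Printing Implicit Defensive.
Import Order.TTheory GRing.Theory Num.Theory.
Import numFieldNormedType.Exports.
Local Open Scope classical_set_scope.
Local Open Scope ring_scope.

(* Points of R^n are n-tuples of reals; the sigma-algebra on n.-tuple R is
   the library's product (Borel) sigma-algebra generated by the coordinates. *)

Section Defs.
Variable R : realType.

Definition unit01 : set R -> \bar R :=
  fun A => lebesgue_measure (A `&` `[0%R, 1%R]).

Fixpoint cube (n : nat) : set (n.-tuple R) -> \bar R :=
  match n return set (n.-tuple R) -> \bar R with
  | 0 => @dirac _ (0.-tuple R) [tuple] R
  | n'.+1 => fun A =>
      ((unit01 \x @cube n')
         ((fun p : R * n'.-tuple R => [tuple of p.1 :: p.2]) @^-1` A))%E
  end.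
Arguments cube : clear implicits.

Definition iint d (T : measurableType d) (mu : set T -> \bar R) (phi : T -> R) : R :=
  fine (\int[mu]_x (phi x)%:E)%E.

Definition L2 d (T : measurableType d) (mu : set T -> \bar R) (phi : T -> R) : Prop :=
  measurable_fun [set: T] phi /\ (\int[mu]_x ((phi x) ^+ 2)%:E < +oo)%E.

Definition Var d (T : measurableType d) (mu : set T -> \bar R) (phi : T -> R) : R :=
  iint mu (fun x => phi x ^+ 2) - (iint mu phi) ^+ 2.

Definition xdrop n (i : 'I_n.+1) (x : n.+1.-tuple R) : n.-tuple R :=
  [tuple tnth x (lift i j) | j < n].

Definition xins n (i : 'I_n.+1) (t : R) (x' : n.-tuple R) : n.+1.-tuple R :=
  [tuple match unlift i j with Some j' => tnth x' j' | None => t end | j < n.+1].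

Definition sobolT_x n (i : 'I_n.+1) (phi : n.+1.-tuple R -> R) : R :=
  (iint (cube n.+1) (fun x => phi x ^+ 2)
   - iint (cube n) (fun x' => (iint unit01 (fun t => phi (xins i t x'))) ^+ 2))
  / Var (cube n.+1) phi.

Definition sobolT_xy d (Y : measurableType d) (muY : set Y -> \bar R)
    n (i : 'I_n.+1) (phi : n.+1.-tuple R * Y -> R) : R :=
  (iint (cube n.+1 \x muY)%E (fun z => phi z ^+ 2)
   - iint (cube n \x muY)%E
       (fun z => (iint unit01 (fun t => phi (xins i t z.1, z.2))) ^+ 2))
  / Var (cube n.+1 \x muY)%E phi.

End Defs.
Arguments cube : clear implicits.

(* Main.v *)
(** Writing [F(t, x')] for [f] with [x_i = t] singled out and [Fbar] for its
    mean in [t], the function [g] has mean [Fbar h1 + h2] in [x_i], for almost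
    every value of the other variables.  Independence of [xi] from the rest
    gives
      [int (a h1 + b)^2 = int a^2 int h1^2 + 2 (h1)_0 int (a b) + int b^2],
    once for [a = f] and once for [a = Fbar], where [b] is [h2] in both cases.
    The cross terms agree by Fubini because [h2] does not involve [x_i], so the
    numerator of the total index of [g] is [int h1^2] times that of [f].  The
    same expansion computes [Var g], and the inequality follows from
    [Var h1 >= 0], [Var h2 >= 0] and the sign of the covariance term. *)

Require Import Defs.
From HB Require Import structures.
From mathcomp Require Import all_boot all_order all_algebra.
From mathcomp Require Import all_classical all_reals all_analysis measurable_realfun.
From mathcomp Require Import ring lra.
Import Order.TTheory GRing.Theory Num.Theory.
Import numFieldNormedType.Exports.
Local Open Scope classical_set_scope.
Local Open Scope ring_scope.

Set Implicit Arguments.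
Unset Strict Implicit.
Unset Printing Implicit Defensive.

(** * Measure-preserving maps *)

Section measure_preserving.
Local Open Scope ereal_scope.
Context {R : realType}.

(** Phrased through integrals of nonnegative functions instead of pushforwards, so that [mu] and
    [nu] can be bare set functions such as [cube] and Tonelli applies directly. *)
Definition measure_preserving d1 d2 (X : measurableType d1)
    (Y : measurableType d2) (mu : set X -> \bar R) (nu : set Y -> \bar R)
    (T : X -> Y) : Prop :=
  measurable_fun [set: X] T /\
  forall f : Y -> \bar R, measurable_fun [set: Y] f -> (forall y, 0 <= f y) ->
    \int[nu]_y f y = \int[mu]_x f (T x).

Lemma measure_preserving_comp d1 d2 d3 (X : measurableType d1)
    (Y : measurableType d2) (Z : measurableType d3)
    (mu : set X -> \bar R) (nu : set Y -> \bar R) (la : set Z -> \bar R)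
    (S : X -> Y) (T : Y -> Z) :
  measure_preserving mu nu S -> measure_preserving nu la T ->
  measure_preserving mu la (T \o S).
Proof.
move=> [mS HS] [mT HT]; split; first exact: measurableT_comp.
move=> f mf f0; rewrite HT// HS//.
exact: (measurableT_comp mf mT).
Qed.

Section transport.
Context d1 d2 (X : measurableType d1) (Y : measurableType d2)
  (mu : {measure set X -> \bar R}) (nu : {measure set Y -> \bar R})
  (T : X -> Y) (HT : measure_preserving mu nu T).

(** The integral of a signed function is the difference of those of its positive and negative parts,
    and both parts commute with composition by [T]. Hence measurability of [f] suffices. *)
Lemma measure_preserving_integral (f : Y -> \bar R) :
  measurable_fun [set: Y] f -> \int[nu]_y f y = \int[mu]_x f (T x).
Proof.
case: HT => mT H mf; rewrite integralE [RHS]integralE; congr (_ - _).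
  rewrite (H f^\+)%E//; last exact: measurable_funepos.
  by under [RHS]eq_integral do rewrite -/(f \o T) funepos_comp/=.
rewrite (H f^\-)%E//; last exact: measurable_funeneg.
by under [RHS]eq_integral do rewrite -/(f \o T) funeneg_comp/=.
Qed.

Lemma measure_preserving_iint (f : Y -> R) :
  measurable_fun [set: Y] f -> iint nu f = iint mu (f \o T).
Proof.
by move=> mf; rewrite /iint measure_preserving_integral//; exact/measurable_EFinP.
Qed.

Lemma measure_preserving_L2 (f : Y -> R) :
  L2 nu f -> L2 mu (f \o T).
Proof.
case: HT => mT H [mf f2]; split; first exact: measurableT_comp.
rewrite -(H (fun y => (f y ^+ 2)%:E))//.
  by apply/measurable_EFinP; exact: measurable_funX.
by move=> y; rewrite lee_fin sqr_ge0.
Qed.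

End transport.

Section products.
Context d1 d2 (X : measurableType d1) (Y : measurableType d2)
  (P : probability X R) (Q : probability Y R).

(** By Tonelli the inner integral is that of a constant against [Q], which has mass 1. *)
Lemma measure_preserving_fst : measure_preserving (P \x Q) P fst.
Proof.
split=> [//|f mf f0].
rewrite (fubini_tonelli1 (fun z => f z.1))//; last exact: (measurableT_comp mf).
apply: eq_integral => x _; rewrite /fubini_F/= integral_cst//.
by rewrite -[LHS]mule1; congr (_ * _); rewrite -(probability_setT Q).
Qed.

Lemma measure_preserving_snd : measure_preserving (P \x Q) Q snd.
Proof.
split=> [//|f mf f0].
rewrite (fubini_tonelli2 (fun z => f z.2))//; last exact: (measurableT_comp mf).
apply: eq_integral => x _; rewrite /fubini_G/= integral_cst//.
by rewrite -[LHS]mule1; congr (_ * _); rewrite -(probability_setT P).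
Qed.

Lemma measure_preserving_swap :
  measure_preserving (P \x Q) (Q \x P)
    (fun z => (z.2, z.1)).
Proof.
have ms : measurable_fun [set: X * Y] (fun z : X * Y => (z.2, z.1)).
  exact: measurable_fun_pair.
split=> [//|f mf f0].
rewrite (fubini_tonelli1 (fun z => f (z.2, z.1)))//; last exact: (measurableT_comp mf).
by rewrite fubini_tonelli2.
Qed.

Lemma measure_preserving_prod d3 d4 (X' : measurableType d3)
    (Y' : measurableType d4) (P' : probability X' R) (Q' : probability Y' R)
    (S : X -> X') (T : Y -> Y') :
  measure_preserving P P' S -> measure_preserving Q Q' T ->
  measure_preserving (P \x Q) (P' \x Q')
    (fun z => (S z.1, T z.2)).
Proof.
move=> [mS HS] [mT HT].
have mST : measurable_fun [set: X * Y] (fun z : X * Y => (S z.1, T z.2)).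
  by apply: measurable_fun_pair; exact: measurableT_comp.
split=> [//|f mf f0].
rewrite (fubini_tonelli1 (fun z => f (S z.1, T z.2)))//; last exact: (measurableT_comp mf).
rewrite fubini_tonelli1// HS; last 2 first.
- exact: measurable_fun_fubini_tonelli_F.
- by move=> y; apply: integral_ge0.
apply: eq_integral => x _; rewrite /fubini_F/= HT//.
exact: measurableT_comp.
Qed.

Lemma measure_preserving_assoc d3 (Z : measurableType d3) (W : probability Z R) :
  measure_preserving
    (P \x (Q \x W)) ((P \x Q) \x W)
    (fun z => ((z.1, z.2.1), z.2.2)).
Proof.
have ma : measurable_fun [set: X * (Y * Z)]
    (fun z : X * (Y * Z) => ((z.1, z.2.1), z.2.2)).
  apply: measurable_fun_pair; last exact: (measurableT_comp measurable_snd).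
  apply: measurable_fun_pair => //.
  exact: (measurableT_comp measurable_fst).
split=> [//|f mf f0].
pose QW : probability (Y * Z)%type R := Q \x W.
pose PQ : probability (X * Y)%type R := P \x Q.
rewrite (fubini_tonelli1 (m1 := P) (m2 := QW)
  (fun z => f ((z.1, z.2.1), z.2.2)))//; last first.
  exact: (measurableT_comp mf).
rewrite (fubini_tonelli1 (m1 := PQ))// fubini_tonelli1//; last 2 first.
- exact: measurable_fun_fubini_tonelli_F.
- by move=> y; apply: integral_ge0.
apply: eq_integral => x _; rewrite /fubini_F/=.
rewrite (fubini_tonelli1 (fun z => f ((x, z.1), z.2)))//.
apply: (measurableT_comp mf).
exact: (measurableT_comp ma (measurable_pair1 x)).
Qed.

End products.
End measure_preserving.

Lemma measure_preserving_id {R : realType} d (X : measurableType d)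
    (mu : set X -> \bar R) : measure_preserving mu mu id.
Proof. by split. Qed.

Lemma measure_preserving_measure {R : realType} d1 d2 (X : measurableType d1)
    (Y : measurableType d2) (mu : {measure set X -> \bar R})
    (nu : {measure set Y -> \bar R}) (T : X -> Y) (A : set Y) :
  measure_preserving mu nu T -> measurable A -> nu A = mu (T @^-1` A).
Proof.
move=> [mT H] mA.
have mTA : measurable (T @^-1` A) by rewrite -[X in measurable X]setTI; exact: mT.
rewrite -[A in LHS]setIT -integral_indic// H//; last exact/measurable_EFinP.
by rewrite -[X in _ = mu X]setIT -integral_indic.
Qed.

(** The preimage of a null set is null. This lifts almost-everywhere statements on one factor to a
    product. *)
Lemma measure_preserving_ae {R : realType} d1 d2 (X : measurableType d1)
    (Y : measurableType d2) (mu : {measure set X -> \bar R})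
    (nu : {measure set Y -> \bar R}) (T : X -> Y) (A : Y -> Prop) :
  measure_preserving mu nu T ->
  {ae nu, forall y, A y} -> {ae mu, forall x, A (T x)}.
Proof.
move=> HT [N [mN N0 sub]]; exists (T @^-1` N); split.
- by case: HT => mT _; rewrite -[X in measurable X]setTI; exact: mT.
- by rewrite -(measure_preserving_measure HT).
- by move=> x /= Ax; exact: sub.
Qed.

(** * Uniform measures on cubes *)

Section cubes.
Local Open Scope ereal_scope.
Context {R : realType}.

Let itv01_measurable : measurable (`[0%R, 1%R]%classic : set R).
Proof. exact: measurable_itv. Qed.

Let unit01E : @unit01 R = mrestr lebesgue_measure itv01_measurable.
Proof. by []. Qed.

Let unit01_0 : unit01 (set0 : set R) = 0.
Proof. by rewrite unit01E measure0. Qed.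
Let unit01_ge0 (A : set R) : 0 <= unit01 A.
Proof. by rewrite unit01E measure_ge0. Qed.
Let unit01_sigma_additive : semi_sigma_additive (@unit01 R).
Proof.
exact: (@measure_semi_sigma_additive _ _ _
  (mrestr lebesgue_measure itv01_measurable)).
Qed.
HB.instance Definition _ := isMeasure.Build _ R R (@unit01 R)
  unit01_0 unit01_ge0 unit01_sigma_additive.
Let unit01_setT : unit01 [set: R] = 1.
Proof. by rewrite /unit01 setTI lebesgue_measure_itv/= lte01 oppr0 adde0. Qed.
HB.instance Definition _ := Measure_isProbability.Build _ _ _ (@unit01 R) unit01_setT.

Lemma measurable_tuple_cons n :
  measurable_fun [set: R * n.-tuple R]
    (fun p : R * n.-tuple R => [tuple of p.1 :: p.2]).
Proof. exact: measurable_cons. Qed.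

(** [cube] is a recursion on set functions and carries no measure structure by itself. At each stage
    it is the distribution of the cons map under a product of probabilities, which supplies that
    structure. *)
Lemma cube_probability n :
  exists P : probability (n.-tuple R) R, cube R n = P.
Proof.
elim: n => [|n [P cP]]; first by exists (dirac [tuple]).
pose c : {mfun (R * n.-tuple R)%type >-> n.+1.-tuple R} :=
  HB.pack (fun p : R * n.-tuple R => [tuple of p.1 :: p.2])
    (isMeasurableFun.Build _ _ _ _ _ (@measurable_tuple_cons n)).
pose Q : probability (R * n.-tuple R)%type R := @unit01 R \x P.
exists (distribution Q c); apply/funext => A.
by rewrite /= cP.
Qed.

Local Arguments cube : simpl never.

Let cube0 n : cube R n set0 = 0.
Proof. by have [P ->] := cube_probability n; rewrite measure0. Qed.
Let cube_ge0 n A : 0 <= cube R n A.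
Proof. by have [P ->] := cube_probability n; rewrite measure_ge0. Qed.
Let cube_sigma_additive n : semi_sigma_additive (cube R n).
Proof.
by have [P ->] := cube_probability n; exact: measure_semi_sigma_additive.
Qed.
HB.instance Definition _ n := isMeasure.Build _ _ R (cube R n)
  (cube0 n) (@cube_ge0 n) (@cube_sigma_additive n).
Let cube_setT n : cube R n setT = 1.
Proof. by have [P ->] := cube_probability n; rewrite probability_setT. Qed.
HB.instance Definition _ n := Measure_isProbability.Build _ _ R (cube R n) (cube_setT n).

Lemma measure_preserving_cons n :
  measure_preserving (@unit01 R \x cube R n) (cube R n.+1)
    (fun p : R * n.-tuple R => [tuple of p.1 :: p.2]).
Proof.
split; first exact: measurable_tuple_cons.
move=> f mf f0.
pose c : {mfun (R * n.-tuple R)%type >-> n.+1.-tuple R} :=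
  HB.pack (fun p : R * n.-tuple R => [tuple of p.1 :: p.2])
    (isMeasurableFun.Build _ _ _ _ _ (@measurable_tuple_cons n)).
rewrite -[LHS]/(\int[pushforward (@unit01 R \x cube R n) c]_y f y).
by rewrite ge0_integral_pushforward.
Qed.

Lemma xins_ord0 n (t : R) (x : n.-tuple R) :
  xins ord0 t x = [tuple of t :: x].
Proof.
apply: eq_from_tnth => j; rewrite tnth_mktuple.
case: unliftP => [j'|] ->; first by rewrite tnthS.
by rewrite tnth0.
Qed.

(** Insertion beyond the head leaves the head in place; this is the recursion behind the induction
    on the dimension in [measure_preserving_xins]. *)
Lemma xins_lift n (i : 'I_n.+1) (t y : R) (x : n.-tuple R) :
  xins (lift ord0 i) t [tuple of y :: x] = [tuple of y :: xins i t x].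
Proof.
apply: eq_from_tnth => j; rewrite tnth_mktuple.
case: (unliftP ord0 j) => [j'|] ->.
  rewrite tnthS tnth_mktuple.
  case: (unliftP i j') => [k|] ->; last by rewrite unlift_none.
  suff -> : lift ord0 (lift i k) = lift (lift ord0 i) (lift ord0 k).
    by rewrite liftK tnthS.
  by apply: val_inj; rewrite /= /bump/= !add1n ltnS addnS.
rewrite tnth0.
have -> : ord0 = lift (lift ord0 i) ord0 :> 'I_n.+2 by exact: val_inj.
by rewrite liftK tnth0.
Qed.

Lemma xdrop_xins n (i : 'I_n.+1) (t : R) (x : n.-tuple R) :
  xdrop i (xins i t x) = x.
Proof. by apply: eq_from_tnth => j; rewrite !tnth_mktuple liftK. Qed.

(** Induction on [n]. Insertion at position 0 is the cons map. Otherwise, peeling off the head [y]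
    turns both sides into iterated integrals of one function that differ only in the order of [y]
    and the inserted [t], which Tonelli exchanges. *)
Lemma measure_preserving_xins n (i : 'I_n.+1) :
  measure_preserving (@unit01 R \x cube R n) (cube R n.+1)
    (fun p : R * n.-tuple R => xins i p.1 p.2).
Proof.
elim: n i => [|n IH] i.
  rewrite (ord1 i).
  under eq_fun do rewrite xins_ord0.
  exact: measure_preserving_cons.
case: (unliftP ord0 i) => [i'|] ->; last first.
  under eq_fun do rewrite xins_ord0.
  exact: measure_preserving_cons.
have mx : measurable_fun [set: R * n.+1.-tuple R]
    (fun p : R * n.+1.-tuple R => xins (lift ord0 i') p.1 p.2).
  apply/measurable_fun_tnthP => j.
  rewrite [X in measurable_fun _ X](_ : _ = fun p : R * n.+1.-tuple R =>
    if unlift (lift ord0 i') j is Some j' then tnth p.2 j' else p.1); last first.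
    by apply/funext => p /=; rewrite tnth_mktuple.
  case: unlift => [j'|]; last exact: measurable_fst.
  exact: (measurableT_comp (measurable_tnth j')).
split=> [//|f mf f0].
have [mc Hc] := measure_preserving_cons n.+1.
have [mc' Hc'] := measure_preserving_cons n.
have [mi Hi] := IH i'.
rewrite Hc// fubini_tonelli1//=; last exact: (measurableT_comp mf).
rewrite (fubini_tonelli1 (fun z => f (xins (lift ord0 i') z.1 z.2)))//; last first.
  exact: (measurableT_comp mf).
rewrite /fubini_F /=.
have mfc y : measurable_fun setT (fun x : n.+1.-tuple R => f [tuple of y :: x]).
  exact: (measurableT_comp mf (measurableT_comp mc (measurable_pair1 y))).
have mfx t : measurable_fun setT (fun x : n.+1.-tuple R => f (xins (lift ord0 i') t x)).
  exact: (measurableT_comp mf (measurableT_comp mx (measurable_pair1 t))).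
under eq_integral => y _.
  rewrite (Hi (fun x => f [tuple of y :: x]))//.
  rewrite fubini_tonelli1//; last exact: (measurableT_comp (mfc y) mi).
  rewrite /fubini_F/=.
  over.
under [RHS]eq_integral => t _.
  rewrite (Hc' (fun x => f (xins (lift ord0 i') t x)))//.
  rewrite fubini_tonelli1//; last exact: (measurableT_comp (mfx t) mc').
  rewrite /fubini_F/=.
  under eq_integral => y _ do under eq_integral => x _ do rewrite xins_lift.
  over.
(* Joint measurability in the head, the inserted coordinate and the rest makes the partial integral
   [G] below measurable, as the exchange requires. *)
have mfinal : measurable_fun setT (fun w : (R * R) * n.-tuple R =>
    f [tuple of w.1.1 :: xins i' w.1.2 w.2]).
  apply: (measurableT_comp mf).
  apply: (measurableT_comp mc (g := fun w : (R * R) * n.-tuple R =>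
    (w.1.1, xins i' w.1.2 w.2))).
  apply: measurable_fun_pair; first exact: (measurableT_comp measurable_fst).
  apply: (measurableT_comp mi (g := fun w : (R * R) * n.-tuple R => (w.1.2, w.2))).
  apply: measurable_fun_pair => //.
  exact: (measurableT_comp measurable_snd).
pose G (p : R * R) := \int[cube R n]_x f [tuple of p.1 :: xins i' p.2 x].
rewrite (fubini_tonelli G)//.
- exact: (measurable_fun_fubini_tonelli_F _ mfinal).
- by move=> p; apply: integral_ge0.
Qed.

Lemma cat_tuple_cons n k (t : R) (x : n.-tuple R) (y : k.-tuple R) :
  cat_tuple [tuple of t :: x] y = [tuple of t :: cat_tuple x y].
Proof. exact: val_inj. Qed.

(** Induction on the length of the first block, peeling off its head on both sides. For an empty
    first block, concatenation is the second projection. *)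
Lemma measure_preserving_cat n k :
  measure_preserving (cube R n \x cube R k) (cube R (n + k))
    (fun p : n.-tuple R * k.-tuple R => cat_tuple p.1 p.2).
Proof.
elim: n => [|n IH].
  rewrite [X in measure_preserving _ _ X](_ : _ = snd).
    exact: measure_preserving_snd.
  by apply/funext => -[x y]; apply: val_inj; rewrite /= (tuple0 x).
have mcat : measurable_fun [set: n.+1.-tuple R * k.-tuple R]
    (fun p : n.+1.-tuple R * k.-tuple R => cat_tuple p.1 p.2).
  apply/measurable_fun_tnthP => j.
  case: (@split_ordP n.+1 k j) => j' ->.
    rewrite [X in measurable_fun _ X](_ : _ = fun p : n.+1.-tuple R * k.-tuple R =>
      tnth p.1 j'); last by apply/funext => p /=; rewrite tnth_lshift.
    exact: (measurableT_comp (measurable_tnth j')).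
  rewrite [X in measurable_fun _ X](_ : _ = fun p : n.+1.-tuple R * k.-tuple R =>
    tnth p.2 j'); last by apply/funext => p /=; rewrite tnth_rshift.
  exact: (measurableT_comp (measurable_tnth j')).
split=> [//|f mf f0].
have [mc Hc] := measure_preserving_cons n.
have [mcat' Hcat] := IH.
have [mc' Hc'] := measure_preserving_cons (n + k).
(* [n.+1 + k] is convertible to [(n + k).+1], so the head of the concatenated tuple can be split
   off. *)
rewrite -[LHS]/(\int[cube R (n + k).+1]_y f y) Hc'//.
rewrite fubini_tonelli1//=; last exact: (measurableT_comp mf).
rewrite (fubini_tonelli1 (fun z => f (cat_tuple z.1 z.2)))//; last first.
  exact: (measurableT_comp mf).
rewrite Hc; last 2 first.
- apply: (measurable_fun_fubini_tonelli_F (fun z => f (cat_tuple z.1 z.2))) => //.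
  exact: (measurableT_comp mf).
- by move=> y; apply: integral_ge0.
rewrite fubini_tonelli1//; last 2 first.
- apply: (measurableT_comp _ mc).
  apply: (measurable_fun_fubini_tonelli_F (fun z => f (cat_tuple z.1 z.2))) => //.
  exact: (measurableT_comp mf).
- by move=> y; apply: integral_ge0.
apply: eq_integral => t _; rewrite /fubini_F/=.
have mft : measurable_fun setT (fun x : (n + k).-tuple R => f [tuple of t :: x]).
  exact: (measurableT_comp mf (measurableT_comp mc' (measurable_pair1 t))).
rewrite Hcat// fubini_tonelli1//; last exact: (measurableT_comp mft mcat').
apply: eq_integral => x _; apply: eq_integral => y _.
by rewrite cat_tuple_cons.
Qed.

End cubes.

(** * Square-integrable functions *)

Section square_integrable.
Context {R : realType} d (X : measurableType d) (P : probability X R).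
Implicit Types f g h : X -> R.

Local Notation rintegrable f := (P.-integrable [set: X] (EFin \o f)).

Lemma le_rintegrable f g : measurable_fun [set: X] f ->
  (forall x, `|f x| <= g x) -> rintegrable g -> rintegrable f.
Proof.
move=> mf fg; apply: le_integrable => //; first exact/measurable_EFinP.
by move=> x _ /=; rewrite lee_fin (le_trans (fg x))// ler_norm.
Qed.

Lemma rintegrableD f g : rintegrable f -> rintegrable g ->
  rintegrable (fun x => f x + g x).
Proof. by move=> hf hg; exact: (integrableD measurableT hf hg). Qed.

Lemma rintegrableZ r f : rintegrable f -> rintegrable (fun x => r * f x).
Proof. by move=> hf; exact: (integrableZl measurableT r hf). Qed.

Lemma rintegrable_cst r : rintegrable (fun=> r).
Proof. exact: (finite_measure_integrable_cst P r measurableT). Qed.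

Lemma rintegrable_measurable f : rintegrable f -> measurable_fun [set: X] f.
Proof. by move/measurable_int/measurable_EFinP. Qed.

Lemma L2P f : L2 P f <->
  measurable_fun [set: X] f /\ rintegrable (fun x => f x ^+ 2).
Proof.
split=> -[mf f2]; split=> //.
  apply/integrableP; split.
    by apply/measurable_EFinP; exact: measurable_funX.
  by under eq_integral => x _ do rewrite /= ger0_norm ?sqr_ge0//.
have /integrableP[_] := f2.
by under eq_integral => x _ do rewrite /= ger0_norm ?sqr_ge0//.
Qed.

(** Domination by [f ^+ 2 + g ^+ 2], which follows from the nonnegativity of the squares of [f + g]
    and [f - g]. *)
Lemma L2_rintegrableM f g : L2 P f -> L2 P g ->
  rintegrable (fun x => f x * g x).
Proof.
move=> /L2P[mf f2] /L2P[mg g2].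
apply: (le_rintegrable (g := fun x => f x ^+ 2 + g x ^+ 2)).
- exact: measurable_funM.
- move=> x; rewrite ler_norml; apply/andP; split.
    have := sqr_ge0 (f x + g x); have := sqr_ge0 (f x); have := sqr_ge0 (g x).
    lra.
  have := sqr_ge0 (f x - g x); have := sqr_ge0 (f x); have := sqr_ge0 (g x).
  lra.
- exact: rintegrableD.
Qed.

Lemma L2_cst r : L2 P (fun=> r).
Proof. by apply/L2P; split=> //; exact: rintegrable_cst. Qed.

(** Constants are square-integrable for a probability, so the product with the constant 1 is
    integrable. *)
Lemma L2_rintegrable f : L2 P f -> rintegrable f.
Proof.
move=> f2; have := L2_rintegrableM f2 (L2_cst 1).
by congr (integrable _ _ _); apply/funext => x /=; rewrite mulr1.
Qed.

Lemma iintD f g : rintegrable f -> rintegrable g ->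
  iint P (fun x => f x + g x) = iint P f + iint P g.
Proof. by move=> hf hg; exact: (RintegralD measurableT hf hg). Qed.

Lemma iintZ r f : rintegrable f -> iint P (fun x => r * f x) = r * iint P f.
Proof. by move=> hf; exact: (RintegralZl r measurableT hf). Qed.

Lemma iint_cst r : iint P (fun=> r) = r.
Proof.
rewrite -[LHS]/(Rintegral P setT (fun=> r)) Rintegral_cst//.
by rewrite [X in fine X](probability_setT P) mulr1.
Qed.

(** The centred form shows both the sign of the variance and the case where it vanishes. *)
Lemma VarE f : L2 P f -> Var P f = iint P (fun x => (f x - iint P f) ^+ 2).
Proof.
move=> Lf; set m := iint P f.
have [_ f2] := (L2P f).1 Lf.
rewrite (_ : (fun x => _) = (fun x => f x ^+ 2 + (- (2 * m) * f x + m ^+ 2))); last first.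
  by apply/funext => x; ring.
have fi := L2_rintegrable Lf.
rewrite iintD//; last first.
  by apply: rintegrableD; [exact: rintegrableZ|exact: rintegrable_cst].
rewrite iintD//; [|exact: rintegrableZ|exact: rintegrable_cst].
by rewrite iintZ// iint_cst /Var -/m; ring.
Qed.

Lemma Var_ge0 f : L2 P f -> 0 <= Var P f.
Proof.
by move=> Lf; rewrite VarE//; apply: Rintegral_ge0 => x _; exact: sqr_ge0.
Qed.

Lemma Var_eq0 f : L2 P f -> Var P f = 0 ->
  {ae P, forall x, f x = iint P f}.
Proof.
move=> Lf; rewrite VarE//; set m := iint P f => V0.
have [mf _] := (L2P f).1 Lf.
have mg : measurable_fun setT (fun x => (f x - m) ^+ 2).
  by apply: measurable_funX; exact: measurable_funB.
have gi : rintegrable (fun x => (f x - m) ^+ 2).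
  rewrite (_ : (fun x => _) = (fun x => f x ^+ 2 + (- (2 * m) * f x + m ^+ 2))); last first.
    by apply/funext => x; ring.
  apply: rintegrableD; first by have [] := (L2P f).1 Lf.
  apply: rintegrableD; last exact: rintegrable_cst.
  exact/rintegrableZ/L2_rintegrable.
have I0 : (\int[P]_x `|((f x - m) ^+ 2)%:E| = 0)%E.
  under eq_integral => x _ do rewrite /= ger0_norm ?sqr_ge0//.
  (* The assumption is about a [fine] value, which is 0 for an infinite integral too; integrability
     of the square rules that case out. *)
  rewrite -[LHS]fineK; first by congr EFin.
  exact: (integrable_fin_num measurableT gi).
have mE : measurable_fun setT (EFin \o (fun x => (f x - m) ^+ 2)).
  exact/measurable_EFinP.
have [+ _] := ae_eq_integral_abs P measurableT mE.
move=> /(_ I0); apply: filterS => x /(_ I) /= /eqP.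
by rewrite eqe sqrf_eq0 subr_eq0 => /eqP.
Qed.

End square_integrable.

(** * Fubini for products of functions, and means over one factor *)

Section product_integrals.
Context {R : realType} d1 d2 (X : measurableType d1) (Y : measurableType d2)
  (P : probability X R) (Q : probability Y R).

Lemma rintegrable_prodM (u : X -> R) (v : Y -> R) :
  P.-integrable setT (EFin \o u) -> Q.-integrable setT (EFin \o v) ->
  (P \x Q)%E.-integrable setT (EFin \o (fun z : X * Y => u z.1 * v z.2)).
Proof.
move=> ui vi.
have mu := rintegrable_measurable ui; have mv := rintegrable_measurable vi.
have muv : measurable_fun [set: X * Y] (fun z : X * Y => u z.1 * v z.2).
  by apply: measurable_funM; exact: measurableT_comp.
apply/integrable12ltyP; first exact/measurable_EFinP.
have /integrableP[_ ui'] := ui; have /integrableP[_ vi'] := vi.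
under eq_integral => x _.
  under eq_integral => y _ do rewrite /= normrM EFinM.
  rewrite ge0_integralZl//; last first.
    by apply/measurable_EFinP; exact: measurableT_comp.
  over.
rewrite /= ge0_integralZr//; last 2 first.
- by apply/measurable_EFinP; exact: measurableT_comp.
- exact: integral_ge0.
apply: lte_mul_pinfty => //; first exact: integral_ge0.
by rewrite ge0_fin_numE//; exact: integral_ge0.
Qed.

Lemma iint_prodM (u : X -> R) (v : Y -> R) :
  P.-integrable setT (EFin \o u) -> Q.-integrable setT (EFin \o v) ->
  iint (P \x Q)%E (fun z : X * Y => u z.1 * v z.2) = iint P u * iint Q v.
Proof.
move=> ui vi; rewrite {1}/iint.
rewrite -(integral12_prod_meas1 (rintegrable_prodM ui vi)).
rewrite -(RintegralZr _ measurableT ui) /Rintegral; congr fine.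
apply: eq_integral => x _; rewrite /fubini_F/= /iint.
under eq_integral => y _ do rewrite EFinM.
by rewrite integralZl// EFinM fineK//; exact: integrable_fin_num.
Qed.

Lemma L2_prodM (u : X -> R) (v : Y -> R) : L2 P u -> L2 Q v ->
  L2 (P \x Q)%E (fun z : X * Y => u z.1 * v z.2).
Proof.
move=> /L2P[mu u2] /L2P[mv v2].
apply/L2P; split.
  by apply: measurable_funM; exact: measurableT_comp.
have := rintegrable_prodM u2 v2.
by congr (integrable _ _ _); apply/funext => z /=; rewrite exprMn.
Qed.

(** Sections of [H] may fail to be integrable, so Tonelli is applied to the positive and negative
    parts separately; their difference and its [fine] value are still measurable. *)
Lemma measurable_iint_section (H : X * Y -> R) : measurable_fun setT H ->
  measurable_fun setT (fun y => iint P (fun x => H (x, y))).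
Proof.
move=> mH; have mE : measurable_fun setT (EFin \o H) by exact/measurable_EFinP.
apply: (measurableT_comp (fine_measurable measurableT)
  (g := fun y => (\int[P]_x (H (x, y))%:E)%E)).
rewrite (_ : (fun y => _) = (fun y => \int[P]_x (EFin \o H)^\+ (x, y)
    - \int[P]_x (EFin \o H)^\- (x, y))%E); last first.
  apply/funext => y; rewrite [LHS]integralE; congr (_ - _)%E.
    by apply: eq_integral => x _; rewrite !funeposE.
  by apply: eq_integral => x _; rewrite !funenegE.
apply: emeasurable_funB.
  apply: (measurable_fun_fubini_tonelli_G (EFin \o H)^\+)%E => //.
  exact: measurable_funepos.
apply: (measurable_fun_fubini_tonelli_G (EFin \o H)^\-)%E => //.
exact: measurable_funeneg.
Qed.

Lemma ae_L2_section (F : X * Y -> R) : L2 (P \x Q)%E F ->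
  {ae Q, forall y, L2 P (fun x => F (x, y))}.
Proof.
move=> /L2P[mF F2]; have := ae_integrable2 F2; apply: filterS => y Fy.
apply/L2P; split=> //.
exact: (measurableT_comp mF (measurable_pair2 y)).
Qed.

(** For almost every [y] the section is in L2 and its variance is nonnegative; integrate over [y].
    The extended-real form also yields the finiteness used in [L2_section_mean]. *)
Lemma le_sqr_section_mean (F : X * Y -> R) : L2 (P \x Q)%E F ->
  (\int[Q]_y ((iint P (fun x => F (x, y))) ^+ 2)%:E
    <= \int[P \x Q]_z ((F z) ^+ 2)%:E)%E.
Proof.
move=> LF; have [mF F2] := (L2P _ F).1 LF.
rewrite -(integral21_prod_meas1 F2).
apply: ae_ge0_le_integral => //.
- by move=> y _; rewrite lee_fin sqr_ge0.
- by apply/measurable_EFinP; apply: measurable_funX; exact: measurable_iint_section.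
- by move=> y _; apply: integral_ge0 => x _; rewrite lee_fin sqr_ge0.
- exact: (measurable_fubini_G F2).
have := ae_L2_section LF; apply: filterS => y Ly _.
have := Var_ge0 Ly; rewrite /Var subr_ge0 -lee_fin => /le_trans; apply.
rewrite /iint fineK//; apply: (integrable_fin_num measurableT).
by have [] := (L2P _ _).1 Ly.
Qed.

Lemma L2_section_mean (F : X * Y -> R) : L2 (P \x Q)%E F ->
  L2 Q (fun y => iint P (fun x => F (x, y))).
Proof.
move=> LF; have [mF F2] := LF.
split; first exact: measurable_iint_section.
exact: le_lt_trans (le_sqr_section_mean LF) F2.
Qed.

Lemma iint_sqr_section_mean_le (F : X * Y -> R) : L2 (P \x Q)%E F ->
  iint Q (fun y => (iint P (fun x => F (x, y))) ^+ 2)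
    <= iint (P \x Q)%E (fun z => (F z) ^+ 2).
Proof.
move=> LF; apply: fine_le.
- apply: (integrable_fin_num measurableT).
  by have [] := (L2P _ _).1 (L2_section_mean LF).
- apply: (integrable_fin_num measurableT).
  by have [] := (L2P _ _).1 LF.
- exact: le_sqr_section_mean.
Qed.

End product_integrals.

(** * First and second moments of a sum with an independent factor *)

Section moments.
Context {R : realType} d1 d2 d3 (X : measurableType d1) (M : measurableType d2)
  (K : measurableType d3)
  (P : probability X R) (N : probability M R) (W : probability K R).
Variables (a : X -> R) (c : M -> R) (b : X * K -> R).
Hypotheses (La : L2 P a) (Lc : L2 N c) (Lb : L2 (P \x W)%E b).

Let G (z : X * (M * K)) := a z.1 * c z.2.1 + b (z.1, z.2.2).

Let XK : probability (X * K)%type R := (P \x W)%E.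
Let G' (w : (X * K) * M) := a w.1.1 * c w.2 + b w.1.
(** Regroups the variables so that the argument of [c] stands alone: [a] and [b] then live on the
    first factor, and the product formula for integrals applies. *)
Let phi (z : X * (M * K)) := ((z.1, z.2.2), z.2.1).

Let NW : probability (M * K)%type R := (N \x W)%E.

Let phiP : measure_preserving (P \x NW)%E (XK \x N)%E phi.
Proof.
pose WN : probability (K * M)%type R := (W \x N)%E.
have H1 : measure_preserving (P \x NW)%E (P \x WN)%E
    (fun z => (z.1, (z.2.2, z.2.1))).
  apply: (measure_preserving_prod (S := id) (T := fun w => (w.2, w.1))).
    exact: measure_preserving_id.
  exact: measure_preserving_swap.
exact: (measure_preserving_comp H1 (measure_preserving_assoc P W N)).
Qed.

Let La' : L2 XK (a \o fst).
Proof. exact: (measure_preserving_L2 (measure_preserving_fst P W) La). Qed.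

Let ac_L2 : L2 (XK \x N)%E (fun w : (X * K) * M => (a \o fst) w.1 * c w.2).
Proof. exact: L2_prodM. Qed.

Let b_L2 : L2 (XK \x N)%E (fun w : (X * K) * M => b w.1).
Proof. exact: (measure_preserving_L2 (measure_preserving_fst XK N) Lb). Qed.

Let mG' : measurable_fun setT G'.
Proof.
apply: measurable_funD; first by case: ac_L2.
by case: b_L2.
Qed.

Let iint_a' : iint XK (a \o fst) = iint P a.
Proof.
rewrite -(measure_preserving_iint (measure_preserving_fst P W))//.
by case: La.
Qed.

Let iint_a'2 : iint XK (fun z => (a \o fst) z ^+ 2) = iint P (fun x => a x ^+ 2).
Proof.
rewrite (measure_preserving_iint (measure_preserving_fst P W))//.
by apply: measurable_funX; case: La.
Qed.

Lemma iint_sum : iint (P \x (N \x W))%E G = iint P a * iint N c + iint (P \x W)%E b.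
Proof.
transitivity (iint (XK \x N)%E G').
  exact: (esym (measure_preserving_iint phiP mG')).
rewrite iintD; [|exact: L2_rintegrable|exact: L2_rintegrable].
rewrite (iint_prodM (L2_rintegrable La') (L2_rintegrable Lc)) iint_a'.
congr (_ + _).
rewrite (measure_preserving_iint (measure_preserving_fst XK N))//.
by case: Lb.
Qed.

Lemma iint_sqr_sum : iint (P \x (N \x W))%E (fun z => G z ^+ 2) =
  iint P (fun x => a x ^+ 2) * iint N (fun y => c y ^+ 2)
  + 2 * iint N c * iint (P \x W)%E (fun z => a z.1 * b z)
  + iint (P \x W)%E (fun z => b z ^+ 2).
Proof.
transitivity (iint (XK \x N)%E (fun w => G' w ^+ 2)).
  exact: (esym (measure_preserving_iint phiP (measurable_funX 2 mG'))).
have a2i := ((L2P _ _).1 La').2; have c2i := ((L2P _ _).1 Lc).2.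
have abi := L2_rintegrableM La' Lb; have ci := L2_rintegrable Lc.
have i1 := rintegrable_prodM a2i c2i.
have i2 := rintegrableZ 2 (rintegrable_prodM abi ci).
have i3 := ((L2P _ _).1 b_L2).2.
(* In each of the first two terms a function of [w.1] multiplies a function of [w.2], so its
   integral factors; the last term depends on [w.1] only. *)
rewrite (_ : (fun w => _) = (fun w : (X * K) * M =>
   (((a \o fst) w.1 ^+ 2 * c w.2 ^+ 2)
   + 2 * ((a \o fst) w.1 * b w.1 * c w.2)) + b w.1 ^+ 2)); last first.
  by apply/funext => w; rewrite /G' /=; ring.
rewrite iintD//; last exact: rintegrableD.
rewrite iintD// iintZ; last exact: (rintegrable_prodM abi ci).
rewrite (iint_prodM a2i c2i) (iint_prodM abi ci) iint_a'2.
congr (_ + _); first by rewrite /=; ring.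
rewrite (measure_preserving_iint (measure_preserving_fst XK N))//.
by apply: measurable_funX; case: Lb.
Qed.

End moments.

(** * Averaging one variable out of the model *)

Section section_mean.
Context {R : realType} d0 d1 d2 d3 (T : measurableType d0) (X : measurableType d1)
  (M : measurableType d2) (K : measurableType d3)
  (Q : probability T R) (P : probability X R) (N : probability M R)
  (W : probability K R).
Variables (F : T * X -> R) (c : M -> R) (b : X * K -> R).
Hypotheses (LF : L2 (Q \x P)%E F) (Lb : L2 (P \x W)%E b).

Let Fbar x := iint Q (fun t => F (t, x)).

(** Since [b] does not depend on the averaged variable [t], it can be moved inside the mean; Fubini
    then gives the joint integral. *)
Lemma iint_section_mean_mul :
  iint (P \x W)%E (fun z => Fbar z.1 * b z) =
  iint ((Q \x P) \x W)%E (fun w => F w.1 * b (w.1.2, w.2)).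
Proof.
pose QP : probability (T * X)%type R := (Q \x P)%E.
pose PW : probability (X * K)%type R := (P \x W)%E.
have LF' : L2 (QP \x W)%E (F \o fst).
  exact: (measure_preserving_L2 (measure_preserving_fst QP W) LF).
have Hb : measure_preserving (QP \x W)%E PW (fun w => (w.1.2, w.2)).
  apply: (measure_preserving_prod (S := snd) (T := id)).
    exact: measure_preserving_snd.
  exact: measure_preserving_id.
have Lb' := measure_preserving_L2 Hb Lb.
have mFb := rintegrable_measurable (L2_rintegrableM LF' Lb').
have HA : measure_preserving (Q \x PW)%E (QP \x W)%E
    (fun z => ((z.1, z.2.1), z.2.2)) := measure_preserving_assoc Q P W.
have LF'' := measure_preserving_L2 HA LF'.
have Lb'' := measure_preserving_L2 HA Lb'.
have Fbi := L2_rintegrableM LF'' Lb''.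
(* Reassociation isolates [t] as the first factor, so that Fubini can integrate over it
   innermost. *)
rewrite [RHS](measure_preserving_iint HA mFb) /iint.
rewrite -(integral21_prod_meas1 (m1 := Q) (m2 := PW) Fbi); congr fine.
have [mb _] := Lb.
apply: ae_eq_integral => //.
- apply/measurable_EFinP; apply: measurable_funM => //.
  apply: (measurableT_comp (f := Fbar)) => //.
  by apply: (measurable_iint_section Q); case: LF.
- exact: (measurable_fubini_G (m1 := Q) (m2 := PW) Fbi).
(* The section of [F] at [x] is known to be integrable only for almost every [x], so the integrands
   are compared almost everywhere. *)
have := measure_preserving_ae (measure_preserving_fst P W) (ae_L2_section LF).
apply: filterS => -[x k] /= Lx _; rewrite /fubini_G/=.
have Fi := L2_rintegrable Lx.
under [RHS]eq_integral => t _ do rewrite EFinM.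
rewrite integralZr// /Fbar EFinM /iint fineK//.
exact: integrable_fin_num.
Qed.

(** With the other variables fixed, [c] and [b] are constants, so linearity gives the mean
    [Fbar * c + b] wherever the section of [F] is integrable, hence almost everywhere. *)
Lemma iint_sqr_section_mean (mc : measurable_fun setT c) :
  iint (P \x (N \x W))%E
    (fun z => iint Q (fun t => F (t, z.1) * c z.2.1 + b (z.1, z.2.2)) ^+ 2) =
  iint (P \x (N \x W))%E (fun z => (Fbar z.1 * c z.2.1 + b (z.1, z.2.2)) ^+ 2).
Proof.
pose NW : probability (M * K)%type R := (N \x W)%E.
have [mF _] := LF; have [mb _] := Lb.
have mc' : measurable_fun setT (fun z : X * (M * K) => c z.2.1).
  apply: (measurableT_comp mc).
  exact: (measurableT_comp measurable_fst).
have mb' : measurable_fun setT (fun z : X * (M * K) => b (z.1, z.2.2)).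
  apply: (measurableT_comp mb).
  apply: measurable_fun_pair => //.
  exact: (measurableT_comp measurable_snd).
congr fine; apply: (ae_eq_integral (mu := (P \x NW)%E)) => //.
- apply/measurable_EFinP; apply: measurable_funX.
  apply: (measurable_iint_section Q (H := fun w : T * (X * (M * K)) =>
    F (w.1, w.2.1) * c w.2.2.1 + b (w.2.1, w.2.2.2))).
  apply: measurable_funD; last exact: (measurableT_comp mb').
  apply: measurable_funM; last exact: (measurableT_comp mc').
  apply: (measurableT_comp mF); apply: measurable_fun_pair => //.
  exact: (measurableT_comp measurable_fst).
- apply/measurable_EFinP; apply: measurable_funX.
  apply: measurable_funD => //; apply: measurable_funM => //.
  apply: (measurableT_comp (f := Fbar)) => //.
  exact: (measurable_iint_section Q).
have := measure_preserving_ae (measure_preserving_fst P NW) (ae_L2_section LF).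
apply: filterS => -[x [xi k]] /= Lx _; congr (_ ^+ 2)%:E.
have Fi := L2_rintegrable Lx.
under [X in iint _ X]eq_fun => t do rewrite (mulrC (F (t, x))).
rewrite iintD; [|exact: rintegrableZ|exact: rintegrable_cst].
by rewrite iintZ// iint_cst mulrC.
Qed.

End section_mean.

(** * Total index of the model *)

Section total_index.
Context {R : realType} (n m k : nat) (i : 'I_n.+1).

Lemma measurable_xdrop : measurable_fun setT (@xdrop R n i).
Proof.
apply/measurable_fun_tnthP => j.
rewrite [X in measurable_fun _ X](_ : _ = (@tnth _ R ^~ (lift i j))).
  exact: measurable_tnth.
by apply/funext => x /=; rewrite tnth_mktuple.
Qed.

(** Pulled back along the insertion map, dropping the [i]-th coordinate becomes the second
    projection. *)
Lemma measure_preserving_xdrop :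
  measure_preserving (cube R n.+1) (cube R n) (@xdrop R n i).
Proof.
split=> [|f mf f0]; first exact: measurable_xdrop.
have [_ H] := @measure_preserving_xins R n i.
rewrite (H (fun x => f (xdrop i x)))//; last first.
  exact: (measurableT_comp mf measurable_xdrop).
have [_ ->//] := measure_preserving_snd (@unit01 R) (cube R n).
by apply: eq_integral => z _; rewrite xdrop_xins.
Qed.

(** This identifies the integrals of [h2] over its own cube with those taken in the variables of the
    model. *)
Lemma measure_preserving_cat_xdrop :
  measure_preserving (cube R n.+1 \x cube R k)%E (cube R (n + k))
    (fun z => cat_tuple (xdrop i z.1) z.2).
Proof.
have H := measure_preserving_prod measure_preserving_xdrop
  (measure_preserving_id (cube R k)).
exact: (measure_preserving_comp H (@measure_preserving_cat R n k)).
Qed.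

Variables (f : n.+1.-tuple R -> R) (h1 : m.-tuple R -> R)
  (h2 : (n + k).-tuple R -> R).
Hypotheses (Lf : L2 (cube R n.+1) f) (Lh1 : L2 (cube R m) h1)
  (Lh2 : L2 (cube R (n + k)) h2).

Let muY := (cube R m \x cube R k)%E.
Let g := fun z : n.+1.-tuple R * (m.-tuple R * k.-tuple R) =>
  f z.1 * h1 z.2.1 + h2 (cat_tuple (xdrop i z.1) z.2.2).
Let f0 := iint (cube R n.+1) f.
Let h10 := iint (cube R m) h1.
Let h20 := iint (cube R (n + k)) h2.
Let fh20 := iint (cube R n.+1 \x cube R k)%E
  (fun z => f z.1 * h2 (cat_tuple (xdrop i z.1) z.2)).
Let intf2 := iint (cube R n.+1) (fun x => f x ^+ 2).
Let inth12 := iint (cube R m) (fun xi => h1 xi ^+ 2).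
Let inth22 := iint (cube R (n + k)) (fun z => h2 z ^+ 2).
Let fbar (x : n.-tuple R) := iint (@unit01 R) (fun t => f (xins i t x)).

Let b (z : n.+1.-tuple R * k.-tuple R) := h2 (cat_tuple (xdrop i z.1) z.2).
Let Lb : L2 (cube R n.+1 \x cube R k)%E b.
Proof. exact: (measure_preserving_L2 measure_preserving_cat_xdrop Lh2). Qed.

Let F (z : R * n.-tuple R) := f (xins i z.1 z.2).
Let LF : L2 (@unit01 R \x cube R n)%E F.
Proof. exact: (measure_preserving_L2 (@measure_preserving_xins R n i) Lf). Qed.

(** The counterpart of [b] once the [i]-th coordinate has been averaged out. *)
Let B (z : n.-tuple R * k.-tuple R) := h2 (cat_tuple z.1 z.2).
Let LB : L2 (cube R n \x cube R k)%E B.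
Proof. exact: (measure_preserving_L2 (@measure_preserving_cat R n k) Lh2). Qed.

(** Stated for any [T] because it serves twice: with the full input [x], and with the [i]-th
    coordinate removed. *)
Let iint_sqr_h2 d (Y : measurableType d) (mu : {measure set Y -> \bar R})
    (T : Y -> (n + k).-tuple R) :
  measure_preserving mu (cube R (n + k)) T ->
  iint mu (fun z => h2 (T z) ^+ 2) = inth22.
Proof.
move=> HT; apply: esym.
apply: (measure_preserving_iint HT (f := fun z => h2 z ^+ 2)).
by apply: measurable_funX; case: Lh2.
Qed.

Lemma iint_model_sqr : iint (cube R n.+1 \x muY)%E (fun z => g z ^+ 2) =
  intf2 * inth12 + 2 * h10 * fh20 + inth22.
Proof.
have -> := iint_sqr_sum Lf Lh1 Lb.
by rewrite (iint_sqr_h2 measure_preserving_cat_xdrop).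
Qed.

Lemma Var_model : Var (cube R n.+1 \x muY)%E g =
  intf2 * inth12 - f0 ^+ 2 * h10 ^+ 2 + (inth22 - h20 ^+ 2)
  + 2 * h10 * (fh20 - f0 * h20).
Proof.
rewrite /Var iint_model_sqr.
have -> : iint (cube R n.+1 \x muY)%E g = f0 * h10 + h20.
  have -> := iint_sum Lf Lh1 Lb; congr (_ + _); apply: esym.
  apply: (measure_preserving_iint measure_preserving_cat_xdrop).
  by case: Lh2.
by ring.
Qed.

(** After Fubini, [t] and the remaining coordinates recombine through [xins] into a point of the
    full cube, and [xdrop] undoes the insertion inside [h2]. *)
Lemma iint_fbar_cross :
  iint (cube R n \x cube R k)%E (fun z => fbar z.1 * B z) = fh20.
Proof.
have -> := iint_section_mean_mul LF LB.
pose QP : probability (R * n.-tuple R)%type R := (@unit01 R \x cube R n)%E.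
have H : measure_preserving (QP \x cube R k)%E (cube R n.+1 \x cube R k)%E
    (fun z => (xins i z.1.1 z.1.2, z.2)).
  exact: (measure_preserving_prod (@measure_preserving_xins R n i)
    (measure_preserving_id (cube R k))).
have mfb : measurable_fun setT (fun z : n.+1.-tuple R * k.-tuple R => f z.1 * b z).
  apply: measurable_funM; last by case: Lb.
  by apply: measurableT_comp => //; case: Lf.
rewrite /fh20 [RHS](measure_preserving_iint H mfb); congr iint.
by apply/funext => z /=; rewrite /B /b /F /= xdrop_xins.
Qed.

(** Both second moments carry the same [fh20] and [inth22] terms, which cancel in the difference. *)
Lemma total_numerator_model :
  iint (cube R n.+1 \x muY)%E (fun z => g z ^+ 2)
   - iint (cube R n \x muY)%E
       (fun z => (iint (@unit01 R) (fun t => g (xins i t z.1, z.2))) ^+ 2)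
  = inth12 * (intf2 - iint (cube R n) (fun x => fbar x ^+ 2)).
Proof.
rewrite iint_model_sqr.
rewrite [X in iint (cube R n \x _)%E X](_ : _ = (fun z => iint (@unit01 R)
    (fun t => F (t, z.1) * h1 z.2.1 + B (z.1, z.2.2)) ^+ 2)); last first.
  by apply/funext => z; rewrite /g /=; under eq_fun do rewrite xdrop_xins.
have -> := iint_sqr_section_mean (cube R m) LF LB (proj1 Lh1).
have -> := iint_sqr_sum (L2_section_mean LF) Lh1 LB.
rewrite [X in _ - (_ + 2 * _ * X + _)]iint_fbar_cross.
rewrite (iint_sqr_h2 (@measure_preserving_cat R n k)).
by rewrite -/h10 -/inth12 /fbar; ring.
Qed.

(** Averaging over one coordinate does not increase the second moment. The sign lets the final
    inequality be reduced to a comparison of denominators. *)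
Lemma total_numerator_ge0 :
  0 <= intf2 - iint (cube R n) (fun x => fbar x ^+ 2).
Proof.
rewrite subr_ge0; apply: (le_trans (iint_sqr_section_mean_le LF)).
rewrite /intf2 (measure_preserving_iint (@measure_preserving_xins R n i))//.
by apply: measurable_funX; case: Lf.
Qed.

End total_index.

(* n = n'.+1 (so n >= 1); the fixed index i ranges over 'I_n (0-based). *)
Theorem theoremA1 (R : realType) (n' m k : nat) (i : 'I_n'.+1)
    (f : n'.+1.-tuple R -> R) (h1 : m.-tuple R -> R)
    (h2 : (n' + k).-tuple R -> R) :
  (0 < m)%N -> (0 < k)%N ->
  L2 (cube R n'.+1) f -> L2 (cube R m) h1 -> L2 (cube R (n' + k)) h2 ->
  ~ (exists c : R, {ae cube R n'.+1, forall x, f x = c}) ->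
  let muY := (cube R m \x cube R k)%E in
  let g := fun z : n'.+1.-tuple R * (m.-tuple R * k.-tuple R) =>
    f z.1 * h1 z.2.1 + h2 (cat_tuple (xdrop i z.1) z.2.2) in
  0 < Var (cube R n'.+1 \x muY)%E g ->
  0 < iint (cube R m) (fun xi => h1 xi ^+ 2) ->
  let f0 := iint (cube R n'.+1) f in
  let h10 := iint (cube R m) h1 in
  let h20 := iint (cube R (n' + k)) h2 in
  let fh20 := iint (cube R n'.+1 \x cube R k)%E
                (fun z => f z.1 * h2 (cat_tuple (xdrop i z.1) z.2)) in
  let intf2 := iint (cube R n'.+1) (fun x => f x ^+ 2) in
  let inth12 := iint (cube R m) (fun xi => h1 xi ^+ 2) in
  let inth22 := iint (cube R (n' + k)) (fun z => h2 z ^+ 2) in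
  let gamma := (intf2 - f0 ^+ 2) /
      (intf2 - f0 ^+ 2 * h10 ^+ 2 / inth12 + (inth22 - h20 ^+ 2) / inth12
       + 2 * h10 * ((fh20 - f0 * h20) / inth12)) in
  sobolT_xy muY i g = gamma * sobolT_x i f /\
  (f0 * h10 * h20 <= h10 * fh20 -> sobolT_xy muY i g <= sobolT_x i f).
Proof.
move=> _ _ Lf Lh1 Lh2 fnc muY g Vg h1pos f0 h10 h20 fh20 intf2 inth12 inth22 gamma.
(* A zero variance would make [f] almost everywhere equal to its mean. *)
have Vf : 0 < Var (cube R n'.+1) f.
  rewrite lt0r Var_ge0// andbT; apply/eqP => V0; apply: fnc.
  by exists f0; exact: Var_eq0.
have N0 := total_numerator_ge0 i Lf.
(* The denominator of [gamma]; it equals the variance of [g] divided by [inth12], and is therefore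
   positive. *)
pose D := intf2 - f0 ^+ 2 * h10 ^+ 2 / inth12 + (inth22 - h20 ^+ 2) / inth12
  + 2 * h10 * ((fh20 - f0 * h20) / inth12).
have h12pos : 0 < inth12 by [].
have h12n0 : inth12 != 0 by rewrite gt_eqF.
have VgE : Var (cube R n'.+1 \x muY)%E g = inth12 * D.
  rewrite (Var_model i Lf Lh1 Lh2) -/f0 -/h10 -/h20 -/fh20 -/intf2 -/inth12 -/inth22.
  by rewrite /D; field.
have Dpos : 0 < D by move: Vg; rewrite VgE pmulr_rgt0.
have Sg : sobolT_xy muY i g =
    (intf2 - iint (cube R n') (fun x' => iint (@unit01 R) (fun t => f (xins i t x')) ^+ 2)) / D.
  rewrite /sobolT_xy (total_numerator_model i Lf Lh1 Lh2) VgE -/inth12 -/intf2.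
  by field; rewrite h12n0 gt_eqF.
have VfE : Var (cube R n'.+1) f = intf2 - f0 ^+ 2 by [].
split.
  rewrite Sg /gamma -/D /sobolT_x VfE -/intf2; move: Vf; rewrite VfE => Vf.
  by field; rewrite !gt_eqF.
move=> cov; rewrite Sg /sobolT_x -/intf2.
(* The two indices now share a nonnegative numerator, so it remains to show that the variance of [f]
   is at most [D]. *)
rewrite ler_wpM2l// lef_pV2// VfE.
(* The excess of [D] over the variance of [f] is written with the variances of [h1] and [h2] and the
   covariance term, each nonnegative. *)
have -> : D = intf2 - f0 ^+ 2 + (f0 ^+ 2 * (inth12 - h10 ^+ 2) + (inth22 - h20 ^+ 2)
    + 2 * (h10 * fh20 - f0 * h10 * h20)) / inth12.
  by rewrite /D; field.
rewrite lerDl divr_ge0 ?(ltW h12pos)//.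
have V1 : 0 <= inth12 - h10 ^+ 2 by exact: (Var_ge0 Lh1).
have V2 : 0 <= inth22 - h20 ^+ 2 by exact: (Var_ge0 Lh2).
apply: addr_ge0; last by rewrite mulr_ge0// subr_ge0.
by rewrite addr_ge0// mulr_ge0// sqr_ge0.
Qed.
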